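(* Let $H$ be a real Hilbert space, let $m\ge1$, let $\mathcal{A}_i:H\to2^H$ ($i=1,\dots,m$) be maximally monotone, let $\mathcal{B}:H\to H$ be monotone and $L$-Lipschitz ($L>0$), let $\mathcal{C}:H\to H$ be $\beta$-cocoercive ($\beta>0$), and assume that the set of $\mathbf{x}\in H$ with $0\in\sum_{i=1}^m\mathcal{A}_i\mathbf{x}+\mathcal{B}\mathbf{x}+\mathcal{C}\mathbf{x}$ is nonempty. Let $\omega_1,\dots,\omega_m\in(0,1]$ with $\sum_i\omega_i=1$, let $\lambda>0$ and $\gamma\in\left(0,\frac{\lambda\beta}{\beta+\lambda(2\beta L+1)}\right)$. Let $\mathbf{x}_0,\mathbf{x}_{-1}\in H$, $(\mathbf{u}_{i,0})_{1\le i\le m}\in H^m$ and iterate, for $n\ge0$, $$\mathbf{x}_{n+1}=\sum_{j=1}^m\omega_j\big(\mathbf{x}_n-\gamma\mathbf{u}_{j,n}-\gamma(2\mathcal{B}\mathbf{x}_n-\mathcal{B}\mathbf{x}_{n-1})-\gamma\mathcal{C}\mathbf{x}_n\big),$$ and for $i=1,\dots,m$: $$\mathbf{y}_{i,n+1}=J_{\frac{\lambda}{\omega_i}\mathcal{A}_i}(2\mathbf{x}_{n+1}-\mathbf{x}_n+\lambda\mathbf{u}_{i,n}),\qquad \mathbf{u}_{i,n+1}=\mathbf{u}_{i,n}+\tfrac1\lambda(2\mathbf{x}_{n+1}-\mathbf{x}_n-\mathbf{y}_{i,n+1}).$$ Then $\{\mathbf{x}_n\}$ converges weakly to a point $\mathbf{x}$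 satisfying $0\in\sum_{i=1}^m\mathcal{A}_i\mathbf{x}+\mathcal{B}\mathbf{x}+\mathcal{C}\mathbf{x}$.
   Context: $J_{T}=(\mathrm{Id}+T)^{-1}$ is the resolvent of a maximally monotone operator $T$. $\beta$-cocoercive means $\langle x-y,\mathcal{C}x-\mathcal{C}y\rangle\ge\beta\|\mathcal{C}x-\mathcal{C}y\|^2$ for all $x,y$. *)

(* Defs.v *)
From HB Require Import structures.
From mathcomp Require Import all_boot all_order all_algebra.
From mathcomp Require Import all_classical all_reals all_analysis.
Set Implicit Arguments. Unset Strict Implicit. Unset Printing Implicit Defensive.
Import Order.TTheory GRing.Theory Num.Theory.
Local Open Scope ring_scope.
Local Open Scope classical_set_scope.

Section Hilbert.
Variables (R : realType) (H : lmodType R).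

Definition is_inner_product (ip : H -> H -> R) : Prop :=
  [/\ (forall x y, ip x y = ip y x),
      (forall a x y z, ip (a *: x + y) z = a * ip x z + ip y z),
      (forall x, 0 <= ip x x) &
      (forall x, ip x x = 0 -> x = 0)].

Definition ipnorm (ip : H -> H -> R) (x : H) : R := Num.sqrt (ip x x).

Definition ip_cauchy (ip : H -> H -> R) (s : nat -> H) : Prop :=
  forall e : R, 0 < e -> exists N : nat, forall p q : nat,
    (N <= p)%N -> (N <= q)%N -> ipnorm ip (s p - s q) < e.

Definition ip_converges (ip : H -> H -> R) (s : nat -> H) (l : H) : Prop :=
  forall e : R, 0 < e -> exists N : nat, forall n : nat,
    (N <= n)%N -> ipnorm ip (s n - l) < e.

Definition is_hilbert (ip : H -> H -> R) : Prop :=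
  is_inner_product ip /\
  (forall s : nat -> H, ip_cauchy ip s -> exists l, ip_converges ip s l).

Definition weakly_converges (ip : H -> H -> R) (s : nat -> H) (l : H) : Prop :=
  forall z : H, ((fun n => ip (s n) z) : R^nat) @ \oo --> (ip l z : R^o).

Definition monotone_op (ip : H -> H -> R) (T : H -> set H) : Prop :=
  forall x y u v, T x u -> T y v -> 0 <= ip (x - y) (u - v).

Definition maximally_monotone (ip : H -> H -> R) (T : H -> set H) : Prop :=
  monotone_op ip T /\
  (forall x u, (forall y v, T y v -> 0 <= ip (x - y) (u - v)) -> T x u).

Definition monotone_fun (ip : H -> H -> R) (B : H -> H) : Prop :=
  forall x y, 0 <= ip (x - y) (B x - B y).

Definition lipschitz_fun (ip : H -> H -> R) (L : R) (B : H -> H) : Prop :=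
  forall x y, ipnorm ip (B x - B y) <= L * ipnorm ip (x - y).

Definition cocoercive (ip : H -> H -> R) (beta : R) (C : H -> H) : Prop :=
  forall x y, beta * (ipnorm ip (C x - C y)) ^+ 2 <= ip (x - y) (C x - C y).

Definition scale_op (c : R) (T : H -> set H) : H -> set H :=
  fun x => [set c *: v | v in T x].

(* y = J_T z = (Id + T)^{-1} z, i.e. z \in y + T y  (for maximally monotone T
   this determines y uniquely, and it exists, by Minty's theorem) *)
Definition resolvent_eq (T : H -> set H) (z y : H) : Prop := T y (z - y).

Definition is_zero_of_sum (m : nat) (A : 'I_m -> H -> set H) (B C : H -> H)
  (x : H) : Prop :=
  exists a : 'I_m -> H, (forall i, A i x (a i)) /\
    \sum_(i < m) a i + B x + C x = 0.

End Hilbert.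

(* Main.v *)
Require Import Defs.
From HB Require Import structures.
From mathcomp Require Import all_boot all_order all_algebra.
From mathcomp Require Import all_classical all_reals all_analysis.
From mathcomp Require Import ring lra.
Set Implicit Arguments. Unset Strict Implicit. Unset Printing Implicit Defensive.
Import Order.TTheory GRing.Theory Num.Theory.
Import numFieldNormedType.Exports.
Local Open Scope ring_scope.
Local Open Scope classical_set_scope.

(** A zero of the sum corresponds to a primal-dual pair [(xs, us)] with
    [w i *: us i] in [A i xs] and [\sum_i w i *: us i + B xs + C xs = 0]. In the
    metric [|p|^2 / gam + \sum_i w i (lam |e i|^2 - 2 <p, e i>)] the iteration is a
    forward-reflected-backward step, and the squared distance to a primal-dual
    pair, corrected by the reflection terms in [B], decreases at each step by a
    multiple of [|x_{n+1} - x_n|^2 + \sum_i w i |u_{i,n+1} - u_{i,n}|^2]; this uses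
    [1 / gam > 1 / lam + 2 L + 1 / beta]. Hence the iterates are bounded and have
    a weak limit along every ultrafilter finer than [\oo]. Such a limit is again
    a primal-dual pair, and two of them agree by Opial's argument, so the whole
    sequence converges weakly. *)

(** * Inner products, Riesz representation and weak limits along filters *)

Section InnerProduct.
Context {R : realType} {H : lmodType R} (ip : H -> H -> R).
Hypothesis ipP : is_inner_product ip.
Implicit Types x y z : H.

Local Notation nrm := (ipnorm ip).

Lemma ipC x y : ip x y = ip y x.
Proof. by case: ipP. Qed.

Lemma ip_ge0 x : 0 <= ip x x.
Proof. by case: ipP. Qed.

Lemma ip_eq0 x : ip x x = 0 -> x = 0.
Proof. by case: ipP => _ _ _; apply. Qed.

Lemma ipDl x y z : ip (x + y) z = ip x z + ip y z.
Proof. by case: ipP => _ lin _ _; rewrite -[x in LHS]scale1r lin mul1r. Qed.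

Lemma ip0l z : ip 0 z = 0.
Proof. by have := ipDl 0 0 z; rewrite addr0; lra. Qed.

Lemma ipZl a x z : ip (a *: x) z = a * ip x z.
Proof. by case: ipP => _ lin _ _; rewrite -[_ *: _]addr0 lin ip0l addr0. Qed.

Lemma ipNl x z : ip (- x) z = - ip x z.
Proof. by rewrite -scaleN1r ipZl mulN1r. Qed.

Lemma ipDr x y z : ip z (x + y) = ip z x + ip z y.
Proof. by rewrite ![ip z _]ipC ipDl. Qed.

Lemma ip0r z : ip z 0 = 0.
Proof. by rewrite ipC ip0l. Qed.

Lemma ipZr a x z : ip z (a *: x) = a * ip z x.
Proof. by rewrite ![ip z _]ipC ipZl. Qed.

Lemma ipNr x z : ip z (- x) = - ip z x.
Proof. by rewrite ![ip z _]ipC ipNl. Qed.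

Definition ipE := (ipDl, ipDr, ipZl, ipZr, ipNl, ipNr, ip0l, ip0r).

Lemma ip_suml (m : nat) (f : 'I_m -> H) z :
  ip (\sum_(i < m) f i) z = \sum_(i < m) ip (f i) z.
Proof. by apply: (big_morph (ip^~ z)) => [x y|]; rewrite ?ipDl ?ip0l. Qed.

Lemma ip_sumr (m : nat) (f : 'I_m -> H) z :
  ip z (\sum_(i < m) f i) = \sum_(i < m) ip z (f i).
Proof. by rewrite ipC ip_suml; apply: eq_bigr => i _; rewrite ipC. Qed.

Lemma ipnorm_ge0 x : 0 <= nrm x.
Proof. exact: sqrtr_ge0. Qed.

Lemma sqr_ipnorm x : nrm x ^+ 2 = ip x x.
Proof. by rewrite sqr_sqrtr // ip_ge0. Qed.

Lemma ip_cauchy_schwarz x y : `|ip x y| <= nrm x * nrm y.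
Proof.
rewrite -(ler_pXn2r (n := 2)) ?nnegrE ?mulr_ge0 ?ipnorm_ge0 //.
rewrite exprMn !sqr_ipnorm real_normK ?num_real //.
have [y0|y_neq0] := eqVneq (ip y y) 0.
  by rewrite (ip_eq0 y0) !ipE; lra.
have y_gt0 : 0 < ip y y by rewrite lt_def y_neq0 ip_ge0.
have := ip_ge0 (ip y y *: x - ip x y *: y).
rewrite !ipE (ipC y x) => h.
rewrite -(ler_pM2l y_gt0); lra.
Qed.

Lemma ip_young (t : R) x y : 0 < t -> 2 * ip x y <= t^-1 * ip x x + t * ip y y.
Proof.
move=> t0; have := ip_ge0 (x - t *: y).
rewrite -(pmulr_rge0 _ (x := t^-1)) ?invr_gt0 // !ipE (ipC y x).
have -> : t^-1 * (ip x x + - (t * ip x y) + (- (t * ip x y) + - - (t * (t * ip y y))))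
   = t^-1 * ip x x + t * ip y y - 2 * ip x y by field; rewrite gt_eqF.
lra.
Qed.

Lemma ipnormD x y : nrm (x + y) <= nrm x + nrm y.
Proof.
rewrite -(ler_pXn2r (n := 2)) ?nnegrE ?addr_ge0 ?ipnorm_ge0 //.
rewrite sqrrD !sqr_ipnorm !ipE (ipC y x).
have := ip_cauchy_schwarz x y; have := ler_norm (ip x y); lra.
Qed.

Lemma ipnormZ a x : nrm (a *: x) = `|a| * nrm x.
Proof.
by rewrite /ipnorm !ipE mulrA -expr2 sqrtrM ?sqr_ge0 // sqrtr_sqr.
Qed.

Lemma ipnormN x : nrm (- x) = nrm x.
Proof. by rewrite -scaleN1r ipnormZ normrN1 mul1r. Qed.

(* [f] is represented by the limit of a minimising sequence of
   [z |-> |z|^2 - 2 f z], which is Cauchy by the parallelogram identity. *)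
Lemma riesz_representation (f : H -> R) (K : R) :
  (forall s : nat -> H, ip_cauchy ip s -> exists l, ip_converges ip s l) ->
  (forall a x y, f (a *: x + y) = a * f x + f y) ->
  (forall x, `|f x| <= K * nrm x) ->
  exists l, forall z, f z = ip l z.
Proof.
move=> cplt flin fbnd.
pose J z := ip z z - 2 * f z.
have Jge z : - K ^+ 2 <= J z.
  rewrite /J -sqr_ipnorm; have := fbnd z; have := ler_norm (f z).
  have := sqr_ge0 (nrm z - K); rewrite sqrrB; lra.
have Jinf : has_inf (range J).
  by split; [exists (J 0), 0|exists (- K ^+ 2) => _ [z _ <-]].
pose eps (n : nat) : R := n.+1%:R^-1.
have eps_gt0 n : 0 < eps n by rewrite invr_gt0 ltr0n.
have /choice[s sP] : forall n : nat, exists z, J z < inf (range J) + eps n.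
  move=> n; have [_ [z _ <-] ?] := inf_adherent (eps_gt0 n) Jinf.
  by exists z.
have infle z : inf (range J) <= J z by apply: ge_inf; [exact: Jinf.2|exists z].
have f0 : f 0 = 0 by have := flin 1 0 0; rewrite scale1r addr0; lra.
have f2 x y : f (2^-1 *: x + 2^-1 *: y) = 2^-1 * f x + 2^-1 * f y.
  by rewrite flin -[2^-1 *: y]addr0 flin f0 addr0.
have sdist p q : nrm (s p - s q) ^+ 2 <= 2 * eps p + 2 * eps q.
  have := sP p; have := sP q; have := infle (2^-1 *: s p + 2^-1 *: s q).
  rewrite sqr_ipnorm /J f2 !ipE (ipC (s q) (s p)); lra.
have epsP (e : R) : 0 < e -> exists N : nat, forall n, (N <= n)%N -> eps n < e.
  move=> e0; have [N _ NP] := near_infty_natSinv_lt (PosNum e0).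
  by exists N => n /NP.
have [|l lP] := cplt s.
  move=> e e0; have [|N NP] := epsP (e ^+ 2 / 4); first by rewrite divr_gt0 ?exprn_gt0.
  exists N => p q /NP hp /NP hq.
  rewrite -(ltr_pXn2r (n := 2)) ?nnegrE ?ipnorm_ge0 ?ltW //.
  have := sdist p q; lra.
exists l => z.
(* Near-minimality of [s n] makes a quadratic in [t] nonnegative; its value at [- d / ip z z] bounds
   [d]. *)
have sz n : (ip (s n) z - f z) ^+ 2 <= eps n * ip z z.
  set d := _ - _.
  have quad t : 0 <= t ^+ 2 * ip z z + 2 * t * d + eps n.
    have := infle (t *: z + s n); have := sP n.
    by rewrite /J flin !ipE (ipC z (s n)) /d; lra.
  have [z0|z_neq0] := eqVneq (ip z z) 0.
    by rewrite /d (ip_eq0 z0) !ipE f0; lra.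
  have z_gt0 : 0 < ip z z by rewrite lt_def z_neq0 ip_ge0.
  have := quad (- d / ip z z).
  rewrite -(pmulr_rge0 _ z_gt0).
  have -> : ip z z * ((- d / ip z z) ^+ 2 * ip z z + 2 * (- d / ip z z) * d + eps n)
     = eps n * ip z z - d ^+ 2 by field.
  lra.
apply/eqP; rewrite -subr_eq0 -normr_le0; apply/ler_addgt0Pr => e e0; rewrite add0r.
pose c := nrm z + 1; have c0 : 0 < c by rewrite ltr_wpDl ?ipnorm_ge0.
have h0 : 0 < e / (2 * c) by rewrite divr_gt0 // mulr_gt0.
have [N1 N1P] := lP _ h0.
have [|N2 N2P] := epsP ((e / (2 * c)) ^+ 2); first by rewrite exprn_gt0.
pose n := maxn N1 N2.
have {}N1P := N1P n (leq_maxl _ _); have {}N2P := N2P n (leq_maxr _ _).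
have -> : f z - ip l z = ip (s n - l) z - (ip (s n) z - f z) by rewrite !ipE; ring.
apply: le_trans (ler_normB _ _) _.
have e2 : e = e / (2 * c) * c + e / (2 * c) * c by field; rewrite gt_eqF.
rewrite [leRHS]e2; apply: lerD.
  apply: le_trans (ip_cauchy_schwarz _ _) _.
  by apply: ler_pM; rewrite ?ipnorm_ge0 // ?ltW // ltrDl.
rewrite -(ler_pXn2r (n := 2)) ?nnegrE ?(mulr_ge0 (ltW h0) (ltW c0)) //.
rewrite real_normK ?num_real // exprMn; apply: le_trans (sz n) _.
rewrite -sqr_ipnorm; apply: ler_pM; rewrite ?sqr_ge0 ?(ltW N2P) ?(ltW (eps_gt0 n)) //.
by rewrite ler_pXn2r ?nnegrE ?ipnorm_ge0 ?(ltW c0) // lerDl.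
Qed.

(** An arbitrary filter is allowed, so that weak cluster points are limits along ultrafilters
    instead of limits of subsequences. *)
Definition weak_cvg_along (F : set_system nat) (s : nat -> H) (l : H) : Prop :=
  forall z, ip (s n) z @[n --> F] --> ip l z.

(** Compactness of the segment gives a cluster point, and an ultrafilter converges to its cluster
    points. *)
Lemma ultrafilter_cvg_bounded (F : set_system nat) (f : nat -> R) (K : R) :
  UltraFilter F -> (forall n, `|f n| <= K) -> exists l : R, f n @[n --> F] --> l.
Proof.
move=> FU fK.
have fKF : (f @ F) `[- K, K] by apply: (@filterE _ F) => n /=; rewrite in_itv /= -ler_norml fK.
have [l [_ lF]] := @segment_compact R (- K) K (f @ F) _ fKF.
exists l => U Ul; have [//|FnU] := in_ultra_setVsetC (f @^-1` U) FU.
by have [v [nUv /nUv]] := lF (~` U) U FnU Ul.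
Qed.

(** The limits of [ip (s n) z] are linear in [z] and bounded by [K * nrm z], so Riesz represents
    them by a vector. *)
Lemma bounded_weak_limit (F : set_system nat) (s : nat -> H) (K : R) :
  (forall s : nat -> H, ip_cauchy ip s -> exists l, ip_converges ip s l) ->
  UltraFilter F -> (forall n, nrm (s n) <= K) ->
  exists l, weak_cvg_along F s l.
Proof.
move=> cplt FU sK.
have sz z n : `|ip (s n) z| <= K * nrm z.
  by apply: le_trans (ip_cauchy_schwarz _ _) _; rewrite ler_wpM2r ?ipnorm_ge0.
have /choice[f fP] : forall z, exists l : R, ip (s n) z @[n --> F] --> l.
  by move=> z; apply: ultrafilter_cvg_bounded (sz z).
have [||l lP] := @riesz_representation f K cplt.
- move=> a x y; have := fP (a *: x + y).
  under eq_fun do rewrite !ipE.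
  move/(cvg_unique (@Rhausdorff R)); apply.
  by apply: cvgD => //; apply: cvgMl_tmp.
- move=> z; rewrite ler_norml; apply/andP; split.
    by apply: (cvgr_to_ge (fP z)); apply: filterE => n; have := sz z n; rewrite ler_norml => /andP[].
  by apply: (cvgr_to_le (fP z)); apply: filterE => n; have := sz z n; rewrite ler_norml => /andP[].
by exists l => z; rewrite -lP.
Qed.

Lemma ip_cvg0 (F : set_system nat) (s t : nat -> H) (K : R) :
  Filter F -> nrm (s n) @[n --> F] --> (0 : R) -> (forall n, nrm (t n) <= K) ->
  ip (s n) (t n) @[n --> F] --> (0 : R).
Proof.
move=> FF s0 tK; apply: norm_cvg0.
apply: (@squeeze_cvgr _ _ _ _ (cst 0) (fun n => nrm (s n) * K)).
- apply: filterE => n /=; rewrite normr_ge0 /=.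
  by apply: le_trans (ip_cauchy_schwarz _ _) _; rewrite ler_wpM2l ?ipnorm_ge0.
- exact: cvg_cst.
- by rewrite -[X in _ --> X](mul0r K); apply: cvgMr_tmp.
Qed.

End InnerProduct.

(** * Weak limits and zeros of sums of monotone operators *)

Section MonotoneSum.
Context {R : realType} {H : lmodType R} (ip : H -> H -> R).
Hypothesis ipP : is_inner_product ip.

Local Notation nrm := (ipnorm ip).

(** Minty's trick with a finite step: at [h = x + (2 * K)^-1 *: d], where [d = v - M x], the
    hypothesis and the Lipschitz bound give [|d|^2 <= |d|^2 / 2]. *)
Lemma lipschitz_monotone_minty (K : R) (M : H -> H) (x v : H) :
  0 < K -> lipschitz_fun ip K M ->
  (forall h, 0 <= ip (x - h) (v - M h)) -> v = M x.
Proof.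
move=> K0 ML xv; set d := v - M x.
have Kn0 : K != 0 by rewrite gt_eqF.
pose h := x + (2 * K)^-1 *: d.
have hx : h - x = (2 * K)^-1 *: d by rewrite /h addrC addKr.
have : 0 <= ip (x - h) (v - M h) := xv h.
rewrite -opprB hx -(subrK (M x) v) -/d -addrA (ipNl ipP) (ipZl ipP) oppr_ge0.
rewrite pmulr_rle0 ?invr_gt0 ?mulr_gt0 // (ipDr ipP) -(opprB (M h)) (ipNr ipP).
move=> dd; apply/eqP; rewrite -subr_eq0 -/d; apply/eqP/(ip_eq0 ipP).
apply: le_anti; rewrite (ip_ge0 ipP) andbT.
have := ML h x; rewrite hx (ipnormZ ipP) gtr0_norm ?invr_gt0 ?mulr_gt0 //.
have -> : K * ((2 * K)^-1 * nrm d) = nrm d / 2 by field.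
move/(ler_wpM2l (ipnorm_ge0 ip d)); rewrite mulrA -expr2 (sqr_ipnorm ipP).
have := ip_cauchy_schwarz ipP d (M h - M x); have := ler_norm (ip d (M h - M x)).
rewrite addrK; lra.
Qed.

(* Maximality makes every [A i] attain a nonpositive value of
   [ip (xs - p) (l i - q)] on its graph, so that an inequality for the sum over
   all graphs splits into one inequality for each operator. *)
Lemma maximally_monotone_split (m : nat) (A : 'I_m -> H -> set H) (l : 'I_m -> H)
    (xs : H) (c : R) :
  (forall i, maximally_monotone ip (A i)) -> c <= 0 ->
  (forall p q : 'I_m -> H, (forall i, A i (p i) (q i)) ->
    0 <= \sum_(i < m) ip (xs - p i) (l i - q i) + c) ->
  0 <= c /\ forall i, A i xs (l i).
Proof.
move=> hA c0 sum_ge0.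
have /choice[t tP] : forall i, exists pq : H * H,
    A i pq.1 pq.2 /\ ip (xs - pq.1) (l i - pq.2) <= 0.
  move=> i; have [Axl|nAxl] := pselect (A i xs (l i)).
    by exists (xs, l i); rewrite /= !subrr (ip0l ipP).
  apply: contra_notP nAxl => /forallNP no_t.
  apply: (hA i).2 => p q Apq; rewrite leNgt; apply/negP => lt0.
  by apply: (no_t (p, q)); split => //=; exact: ltW.
have sum_le0 (P : pred 'I_m) :
    \sum_(i < m | P i) ip (xs - (t i).1) (l i - (t i).2) <= 0.
  by apply: sumr_le0 => i _; case: (tP i).
split.
  have := sum_ge0 (fun i => (t i).1) (fun i => (t i).2) (fun i => (tP i).1).
  have := sum_le0 predT; lra.
move=> i; apply: (hA i).2 => p q Apq.
(* Only the [i]-th pair is replaced; the other terms and [c] are nonpositive, so the [i]-th term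
   must be nonnegative. *)
have := sum_ge0 (fun j => if j == i then p else (t j).1)
                (fun j => if j == i then q else (t j).2).
rewrite (bigD1 i) //= eqxx.
under eq_bigr => j /negPf ji do rewrite ji.
have := sum_le0 (fun j => j != i).
move=> h1 h2; have {h2}/h2 : forall j, A j (if j == i then p else (t j).1)
    (if j == i then q else (t j).2).
  by move=> j; case: eqP => [->|_] //; case: (tP j).
move: h1 c0; set s := bigop _ _ _; lra.
Qed.

(** Weak convergence alone does not control the products of [x n] with [a i n] and [M (x n)]. Their
    sum is the product of [x n] with a residual vanishing in norm, so the summed monotonicity
    inequalities pass to the limit. *)
Lemma weak_limit_is_zero (F : set_system nat) (m : nat) (A : 'I_m -> H -> set H)
    (M : H -> H) (K D : R) (D' : 'I_m -> R) (x : nat -> H) (a y : 'I_m -> nat -> H)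
    (xs : H) (l : 'I_m -> H) :
  ProperFilter F -> (forall i, maximally_monotone ip (A i)) ->
  0 < K -> monotone_fun ip M -> lipschitz_fun ip K M ->
  (forall n, nrm (x n) <= D) -> (forall i n, nrm (a i n) <= D' i) ->
  (forall i n, A i (y i n) (a i n)) ->
  (forall i, nrm (y i n - x n) @[n --> F] --> (0 : R)) ->
  nrm (\sum_(i < m) a i n + M (x n)) @[n --> F] --> (0 : R) ->
  weak_cvg_along ip F x xs -> (forall i, weak_cvg_along ip F (a i) (l i)) ->
  (forall i, A i xs (l i)) /\ \sum_(i < m) l i + M xs = 0.
Proof.
move=> FF hA K0 Mm ML xD aD Aya yx aM xw aw.
pose r n := \sum_(i < m) a i n + M (x n).
have key (p q : 'I_m -> H) h : (forall i, A i (p i) (q i)) ->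
    0 <= \sum_(i < m) ip (xs - p i) (l i - q i)
         + ip (xs - h) (- (\sum_(i < m) l i) - M h).
  move=> Apq.
  pose f i n := ip (y i n - x n) (a i n) - ip (y i n - x n) (q i)
    - ip (x n) (q i) - ip (a i n) (p i) + ip (p i) (q i) + ip (a i n) h.
  pose g n := \sum_(i < m) f i n
    + (ip (r n) (x n) - ip (x n) (M h) - ip (r n) h + ip h (M h)).
  have g_ge0 n : 0 <= g n.
    have -> : g n = \sum_(i < m) ip (y i n - p i) (a i n - q i)
                    + ip (x n - h) (M (x n) - M h).
      have -> : \sum_(i < m) ip (y i n - p i) (a i n - q i) =
          \sum_(i < m) f i n + \sum_(i < m) ip (a i n) (x n - h).
        rewrite -big_split /=; apply: eq_bigr => i _; rewrite /f !(ipE ipP).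
        rewrite (ipC ipP (x n) (a i n)) (ipC ipP (p i) (a i n)); ring.
      rewrite -(ip_suml ipP) /g /r !(ipE ipP).
      rewrite (ipC ipP (x n) (M (x n))) (ipC ipP h (M (x n))); ring.
    by rewrite addr_ge0 // sumr_ge0 // => i _; apply: (hA i).1.
  pose fl i := 0 - 0 - ip xs (q i) - ip (l i) (p i) + ip (p i) (q i) + ip (l i) h.
  have f_cvg i : f i n @[n --> F] --> fl i.
    apply: cvgD; last exact: aw.
    apply: cvgD; last exact: cvg_cst.
    apply: cvgB; last exact: aw.
    apply: cvgB; last exact: xw.
    apply: cvgB; first exact: (ip_cvg0 ipP _ (yx i) (aD i)).
    exact: (ip_cvg0 ipP (t := cst (q i)) (K := nrm (q i)) _ (yx i) (fun=> lexx _)).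
  have : g n @[n --> F] --> \sum_(i < m) fl i + (0 - ip xs (M h) - 0 + ip h (M h)).
    apply: cvgD.
      by apply: cvg_big => //; apply: add_continuous.
    apply: cvgD; last exact: cvg_cst.
    apply: cvgB; last exact: (ip_cvg0 ipP (t := cst h) (K := nrm h) _ aM (fun=> lexx _)).
    apply: cvgB; last exact: xw.
    exact: (ip_cvg0 ipP _ aM xD).
  move/cvgr_to_ge => /(_ 0) /(_ (filterE _ g_ge0)).
  suff -> : \sum_(i < m) fl i + (0 - ip xs (M h) - 0 + ip h (M h)) =
    \sum_(i < m) ip (xs - p i) (l i - q i)
         + ip (xs - h) (- (\sum_(i < m) l i) - M h) by [].
  have -> : \sum_(i < m) ip (xs - p i) (l i - q i) =
     \sum_(i < m) fl i + \sum_(i < m) ip (l i) (xs - h).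
    rewrite -big_split /=; apply: eq_bigr => i _; rewrite /fl !(ipE ipP).
    rewrite (ipC ipP xs (l i)) (ipC ipP (p i) (l i)); ring.
  rewrite -(ip_suml ipP) !(ipE ipP).
  rewrite (ipC ipP xs (\sum_(_ < _) _)) (ipC ipP h (\sum_(_ < _) _)); ring.
(* The test point [h = xs] removes the term in [M]. *)
have [_ Al] : 0 <= (0 : R) /\ forall i, A i xs (l i).
  apply: maximally_monotone_split => // p q Apq.
  by have := key p q xs Apq; rewrite subrr (ip0l ipP).
split=> //; apply/eqP; rewrite addrC -[_ == _]subr_eq0 subr0 addr_eq0 eq_sym; apply/eqP.
(* Conversely, [p = xs] and [q = l] remove the terms in [A i] and leave Minty's inequality for
   [M]. *)
apply: (lipschitz_monotone_minty K0 ML) => h.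
have := key (fun=> xs) l h Al.
by rewrite big1 ?add0r // => i _; rewrite subrr (ip0l ipP).
Qed.

End MonotoneSum.

(** * One-step decrease of the Lyapunov function *)

Section Iteration.
Context {R : realType} {H : lmodType R} (ip : H -> H -> R).
Hypothesis ipP : is_inner_product ip.
Hypothesis cplt :
  forall s : nat -> H, ip_cauchy ip s -> exists l, ip_converges ip s l.
Context {m : nat} (A : 'I_m -> H -> set H) (B C : H -> H) (L beta : R).
Hypothesis hA : forall i, maximally_monotone ip (A i).
Hypothesis L0 : 0 < L.
Hypothesis Bmono : monotone_fun ip B.
Hypothesis Blip : lipschitz_fun ip L B.
Hypothesis beta0 : 0 < beta.
Hypothesis Ccoco : cocoercive ip beta C.
Context (w : 'I_m -> R) (lam gam theta : R).
Hypothesis w0 : forall i, 0 < w i.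
Hypothesis w1 : forall i, w i <= 1.
Hypothesis wsum : \sum_(i < m) w i = 1.
Hypothesis lam0 : 0 < lam.
Hypothesis gam0 : 0 < gam.
Hypothesis theta0 : 0 < theta.
Hypothesis theta_lt : theta < lam.
Hypothesis gap : theta^-1 + 2 * L + beta^-1 < gam^-1.
Context (x : nat -> H) (u y : 'I_m -> nat -> H).
Hypothesis x_step : forall n, x n.+2 = x n.+1 - gam *:
  (\sum_(j < m) w j *: u j n.+1 + (2 *: B (x n.+1) - B (x n)) + C (x n.+1)).
Hypothesis A_yu : forall i n, A i (y i n.+1) (w i *: u i n.+1).
Hypothesis y_eq : forall i n,
  y i n.+1 = 2 *: x n.+1 - x n - lam *: (u i n.+1 - u i n).

Local Notation nrm := (ipnorm ip).

Lemma wsum_const (c : R) : \sum_(i < m) w i * c = c.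
Proof. by rewrite -mulr_suml wsum mul1r. Qed.

Lemma wsum_sqr_ge0 (e : 'I_m -> H) : 0 <= \sum_(i < m) w i * ip (e i) (e i).
Proof. by apply: sumr_ge0 => i _; rewrite mulr_ge0 ?ip_ge0 // ltW. Qed.

Lemma lam_theta_ge0 : 0 <= lam - theta.
Proof. by rewrite subr_ge0 ltW. Qed.

Lemma gap_ge0 : 0 <= gam^-1 - theta^-1 - 2 * L - beta^-1.
Proof. by move: gap; lra. Qed.

Lemma cocoercive_lipschitz : lipschitz_fun ip beta^-1 C.
Proof.
move=> p q; have [c0|c_neq0] := eqVneq (nrm (C p - C q)) 0.
  by rewrite c0 mulr_ge0 ?ipnorm_ge0 // invr_ge0 ltW.
have c_gt0 : 0 < nrm (C p - C q) by rewrite lt_def c_neq0 ipnorm_ge0.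
rewrite ler_pdivlMl // -(ler_pM2r c_gt0) -mulrA -expr2.
apply: le_trans (Ccoco p q) (le_trans (ler_norm _) _).
exact: ip_cauchy_schwarz.
Qed.

Lemma forward_monotone : monotone_fun ip (fun z => B z + C z).
Proof.
move=> p q; rewrite opprD addrACA (ipDr ipP) addr_ge0 //.
by apply: le_trans (Ccoco p q); rewrite mulr_ge0 ?sqr_ge0 // ltW.
Qed.

Lemma forward_lipschitz : lipschitz_fun ip (L + beta^-1) (fun z => B z + C z).
Proof.
move=> p q; rewrite opprD addrACA mulrDl.
apply: le_trans (ipnormD ipP _ _) _; apply: lerD; first exact: Blip.
exact: cocoercive_lipschitz.
Qed.

(** The dual variables carry a factor [(w i)^-1], matching the resolvent parameter [lam / w i]. *)
Definition primal_dual_solution (xs : H) (us : 'I_m -> H) : Prop :=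
  (forall i, A i xs (w i *: us i)) /\
  \sum_(i < m) w i *: us i + (B xs + C xs) = 0.

(* A squared norm on [H * H ^ m], positive definite because [gam < lam]: the
   iteration is a preconditioned forward-reflected-backward step in its metric. *)
Definition energy (p : H) (e : 'I_m -> H) : R :=
  \sum_(i < m) w i * (gam^-1 * ip p p + lam * ip (e i) (e i) - 2 * ip p (e i)).

(** The inner product compensates the reflection in [B]; the last term pays in advance for the
    Lipschitz error of the following step. *)
Definition lyapunov (xs : H) (us : 'I_m -> H) (n : nat) : R :=
  energy (x n.+1 - xs) (fun i => u i n.+1 - us i)
  - 2 * ip (x n.+1 - xs) (B (x n.+1) - B (x n))
  + L * ip (x n.+1 - x n) (x n.+1 - x n).

(** Young's inequality with weight [theta] splits the cross term; [gam < theta < lam] keeps both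
    coefficients positive. *)
Lemma energy_ge (p : H) (e : 'I_m -> H) :
  (gam^-1 - theta^-1) * ip p p + (lam - theta) * \sum_(i < m) w i * ip (e i) (e i)
  <= energy p e.
Proof.
rewrite -[X in X + _]wsum_const mulr_sumr -big_split /=; apply: ler_sum => i _.
rewrite [(lam - theta) * _]mulrCA -mulrDr ler_pM2l //.
have := ip_young ipP p (e i) theta0; lra.
Qed.

Lemma lipschitz_young (p q r : H) :
  2 * `|ip r (B p - B q)| <= L * (ip r r + ip (p - q) (p - q)).
Proof.
have := ip_cauchy_schwarz ipP r (B p - B q).
have := ler_wpM2l (ipnorm_ge0 ip r) (Blip p q).
rewrite -!(sqr_ipnorm ipP).
have := mulr_ge0 (ltW L0) (sqr_ge0 (nrm r - nrm (p - q))); rewrite sqrrB; nra.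
Qed.

Lemma energy_step (xs : H) (us : 'I_m -> H) n : primal_dual_solution xs us ->
  energy (x n.+2 - xs) (fun i => u i n.+2 - us i)
  + (gam^-1 - theta^-1) * ip (x n.+2 - x n.+1) (x n.+2 - x n.+1)
  + (lam - theta) * \sum_(i < m) w i * ip (u i n.+2 - u i n.+1) (u i n.+2 - u i n.+1)
  <= energy (x n.+1 - xs) (fun i => u i n.+1 - us i)
     - 2 * ip (x n.+2 - xs) (2 *: B (x n.+1) - B (x n) - B xs)
     - 2 * ip (x n.+2 - xs) (C (x n.+1) - C xs).
Proof.
move=> [Axs sum0]; set p := x n.+2 - x n.+1; set X := x n.+2 - xs.
have gam_neq0 : gam != 0 by rewrite gt_eqF.
(* The recursion for [x] and the equation of the solution turn the dual differences into forward
   terms. *)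
have drive : \sum_(i < m) w i * (ip X (u i n.+1 - us i) + gam^-1 * ip X p) =
    - ip X (2 *: B (x n.+1) - B (x n) - B xs) - ip X (C (x n.+1) - C xs).
  have -> : \sum_(i < m) w i * (ip X (u i n.+1 - us i) + gam^-1 * ip X p) =
     ip X (\sum_(i < m) w i *: u i n.+1) - ip X (\sum_(i < m) w i *: us i)
     + gam^-1 * ip X p.
    rewrite -[gam^-1 * ip X p in RHS]wsum_const !(ip_sumr ipP) -sumrB -big_split /=.
    by apply: eq_bigr => i _; rewrite !(ipE ipP); ring.
  have -> : \sum_(i < m) w i *: us i = - (B xs + C xs) by apply/eqP; rewrite -addr_eq0 sum0.
  have -> : p = - gam *: (\sum_(j < m) w j *: u j n.+1
      + (2 *: B (x n.+1) - B (x n)) + C (x n.+1)).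
    by rewrite /p x_step addrC addKr scaleNr.
  by rewrite !(ipE ipP); field.
(* Polarisation in the metric; the formula for [y] gathers the remaining cross terms into products
   whose sign is given by monotonicity of [A i]. *)
have -> : energy X (fun i => u i n.+2 - us i) =
   energy (x n.+1 - xs) (fun i => u i n.+1 - us i)
   + 2 * \sum_(i < m) w i * (ip X (u i n.+1 - us i) + gam^-1 * ip X p)
   - gam^-1 * ip p p
   - \sum_(i < m) w i * (lam * ip (u i n.+2 - u i n.+1) (u i n.+2 - u i n.+1)
                         - 2 * ip p (u i n.+2 - u i n.+1))
   - 2 * \sum_(i < m) ip (y i n.+2 - xs) (w i *: u i n.+2 - w i *: us i).
  rewrite -[gam^-1 * ip p p]wsum_const !mulr_sumr -big_split -!sumrB /=.
  apply: eq_bigr => i _.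
  have -> : y i n.+2 = x n.+2 + p - lam *: (u i n.+2 - u i n.+1).
    by rewrite y_eq /p scaler_nat mulr2n !addrA.
  rewrite /X /p !(ipE ipP).
  rewrite (ipC ipP xs (x n.+2)) (ipC ipP (x n.+1) (x n.+2)) (ipC ipP xs (x n.+1)).
  rewrite (ipC ipP (us i)) (ipC ipP (us i) (u i n.+1)) (ipC ipP (u i n.+1) (u i n.+2)).
  rewrite ?(ipC ipP (us i) (u i n.+2)) ?(ipC ipP (us i) (u i n.+1)).
  ring.
have monoA : 0 <= \sum_(i < m) ip (y i n.+2 - xs) (w i *: u i n.+2 - w i *: us i).
  by apply: sumr_ge0 => i _; apply: (hA i).1.
have young :
    (lam - theta) * \sum_(i < m) w i * ip (u i n.+2 - u i n.+1) (u i n.+2 - u i n.+1)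
    <= theta^-1 * ip p p
       + \sum_(i < m) w i * (lam * ip (u i n.+2 - u i n.+1) (u i n.+2 - u i n.+1)
                             - 2 * ip p (u i n.+2 - u i n.+1)).
  rewrite -[theta^-1 * _]wsum_const mulr_sumr -big_split /=; apply: ler_sum => i _.
  rewrite [(lam - theta) * _]mulrCA -mulrDr ler_pM2l //.
  have := ip_young ipP p (u i n.+2 - u i n.+1) theta0; lra.
rewrite drive; lra.
Qed.

(** The terms in [B] telescope to a nonnegative product and a remainder
    [ip p (B (x n.+1) - B (x n))]. Of the loss [2 * L], one [L] comes from this remainder and one
    from the last term of [lyapunov] at [n.+1]. *)
Lemma lyapunov_step (xs : H) (us : 'I_m -> H) n : primal_dual_solution xs us ->
  (gam^-1 - theta^-1 - 2 * L - beta^-1) * ip (x n.+2 - x n.+1) (x n.+2 - x n.+1)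
  + (lam - theta) * \sum_(i < m) w i * ip (u i n.+2 - u i n.+1) (u i n.+2 - u i n.+1)
  <= lyapunov xs us n - lyapunov xs us n.+1.
Proof.
move=> sol; rewrite /lyapunov; have := energy_step n sol.
set E2 := energy _ _; set E1 := energy _ _; set S := \sum_(i < m) _.
set p := x n.+2 - x n.+1; set X := x n.+2 - xs; set p1 := x n.+1 - x n.
have Xp : x n.+1 - xs = X - p by rewrite /X /p opprB [in RHS]addrC addrA subrK.
have monoB : 0 <= ip X (B (x n.+2) - B xs) by apply: Bmono.
(* Writing [X = (X - p) + p], cocoercivity gains a multiple of [ip c c] that pays for Young's
   inequality with weight [beta] on [ip p c]. *)
have cocoC : - (2 * ip X (C (x n.+1) - C xs)) <= beta^-1 * ip p p.
  have := Ccoco (x n.+1) xs; rewrite Xp (sqr_ipnorm ipP).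
  set c := C _ - C _.
  have := ip_young ipP (- p) c beta0; have := mulr_ge0 (ltW beta0) (ip_ge0 ipP c).
  rewrite !(ipE ipP); lra.
have lipB := lipschitz_young (x n.+1) (x n) p.
rewrite Xp; move: monoB cocoC lipB; rewrite -/p1.
have := ler_norm (- ip p (B (x n.+1) - B (x n))); rewrite normrN.
set N := `|_|; rewrite !(ipE ipP); lra.
Qed.

(** The cross term costs [L] times two squares: the increment's is the last term of [lyapunov], and
    [gap] still leaves [L] after the other. *)
Lemma lyapunov_ge (xs : H) (us : 'I_m -> H) n :
  L * ip (x n.+1 - xs) (x n.+1 - xs)
  + (lam - theta) * \sum_(i < m) w i * ip (u i n.+1 - us i) (u i n.+1 - us i)
  <= lyapunov xs us n.
Proof.
rewrite /lyapunov; have := energy_ge (x n.+1 - xs) (fun i => u i n.+1 - us i).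
set E := energy _ _; set S := \sum_(i < m) _; set X := x n.+1 - xs.
have := lipschitz_young (x n.+1) (x n) X.
have := ler_norm (ip X (B (x n.+1) - B (x n))).
have : 0 <= (gam^-1 - theta^-1 - 2 * L) * ip X X.
  rewrite mulr_ge0 ?ip_ge0 //; have : 0 < beta^-1 by rewrite invr_gt0.
  by move: gap; lra.
lra.
Qed.

Lemma lyapunov_nonincreasing (xs : H) (us : 'I_m -> H) n :
  primal_dual_solution xs us -> lyapunov xs us n.+1 <= lyapunov xs us n.
Proof.
move=> sol; rewrite -subr_ge0; apply: le_trans (lyapunov_step n sol).
by rewrite addr_ge0 ?mulr_ge0 ?ip_ge0 ?gap_ge0 ?lam_theta_ge0 ?wsum_sqr_ge0.
Qed.

Lemma lyapunov_cvg (xs : H) (us : 'I_m -> H) :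
  primal_dual_solution xs us -> cvgn (lyapunov xs us).
Proof.
move=> sol; apply: nonincreasing_is_cvgn.
  by apply/nonincreasing_seqP => n; exact: lyapunov_nonincreasing.
exists 0 => _ [n _ <-]; apply: le_trans (lyapunov_ge xs us n).
by rewrite addr_ge0 ?mulr_ge0 ?ip_ge0 ?(ltW L0) ?lam_theta_ge0 ?wsum_sqr_ge0.
Qed.

Lemma summand_le (c : R) (e : 'I_m -> H) (i : 'I_m) :
  0 <= c -> c * w i * ip (e i) (e i) <= c * \sum_(j < m) w j * ip (e j) (e j).
Proof.
move=> c0; rewrite -mulrA ler_wpM2l // (bigD1 i) //= lerDl.
by apply: sumr_ge0 => j _; rewrite mulr_ge0 ?ip_ge0 // ltW.
Qed.

(** The decrements of a convergent [W] tend to [limn W - limn W] and dominate the squared norms. *)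
Lemma ipnorm_cvg0_decrement (W : R^nat) (s : nat -> H) (c : R) :
  0 < c -> cvgn W -> (forall n, c * ip (s n) (s n) <= W n - W n.+1) ->
  nrm (s n) @[n --> \oo] --> (0 : R).
Proof.
move=> c0 Wcvg sW.
have : ip (s n) (s n) @[n --> \oo] --> (0 : R).
  apply: (@squeeze_cvgr _ _ _ _ (cst 0) (fun n => c^-1 * (W n - W n.+1))).
  - by apply: filterE => n /=; rewrite ip_ge0 //= ler_pdivlMl.
  - exact: cvg_cst.
  - have W0 : W n - W n.+1 @[n --> \oo] --> limn W - limn W.
      by apply: cvgB => //; rewrite (cvg_shiftS W).
    rewrite -[X in _ --> X](mulr0 c^-1) -(subrr (limn W)).
    exact: cvgMl_tmp.
move=> s0; rewrite -[X in _ --> X]sqrtr0.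
exact: cvg_comp s0 (@sqrt_continuous R 0).
Qed.

(** * Vanishing increments, boundedness and weak limits of the iterates *)

Section Trajectory.
Context (x0 : H) (u0 : 'I_m -> H).
Hypothesis sol0 : primal_dual_solution x0 u0.

Lemma x_diff_cvg0 : nrm (x n.+1 - x n) @[n --> \oo] --> (0 : R).
Proof.
rewrite -(cvg_shiftS (fun n => nrm (x n.+1 - x n))) /=.
apply: (ipnorm_cvg0_decrement (c := gam^-1 - theta^-1 - 2 * L - beta^-1) _
  (lyapunov_cvg sol0)); last first.
  move=> n; apply: le_trans (lyapunov_step n sol0).
  by rewrite lerDl mulr_ge0 ?lam_theta_ge0 ?wsum_sqr_ge0.
by move: gap; lra.
Qed.

Lemma u_diff_cvg0 i : nrm (u i n.+1 - u i n) @[n --> \oo] --> (0 : R).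
Proof.
rewrite -(cvg_shiftS (fun n => nrm (u i n.+1 - u i n))) /=.
apply: (ipnorm_cvg0_decrement (c := (lam - theta) * w i) _ (lyapunov_cvg sol0)).
  by rewrite mulr_gt0 ?subr_gt0.
move=> n; apply: le_trans (lyapunov_step n sol0).
apply: le_trans (summand_le (fun i => u i n.+2 - u i n.+1) i lam_theta_ge0) _.
by rewrite lerDr mulr_ge0 ?ip_ge0 ?gap_ge0.
Qed.

Lemma lyapunov_le n : lyapunov x0 u0 n <= lyapunov x0 u0 0.
Proof.
by elim: n => // n; apply: le_trans; exact: lyapunov_nonincreasing.
Qed.

(** The bound [t <= 1 + t ^+ 2] passes from the squared distance to the norm without a square
    root. *)
Lemma ipnorm_le_sqr (c W : R) (p q : H) :
  0 < c -> c * ip (p - q) (p - q) <= W -> nrm p <= nrm q + (1 + W / c).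
Proof.
move=> c0 cW; rewrite -[p in nrm p](subrK q) addrC.
apply: le_trans (ipnormD ipP _ _) _; rewrite lerD2l.
apply: (@le_trans _ _ (1 + ip (p - q) (p - q))).
  by rewrite -(sqr_ipnorm ipP); have := sqr_ge0 (nrm (p - q) - 1); rewrite sqrrB; nra.
by rewrite lerD2l ler_pdivlMr // mulrC.
Qed.

Lemma x_bounded : exists D, forall n, nrm (x n.+1) <= D.
Proof.
exists (nrm x0 + (1 + lyapunov x0 u0 0 / L)) => n; apply: ipnorm_le_sqr L0 _.
apply: le_trans (lyapunov_le n); apply: le_trans (lyapunov_ge x0 u0 n).
by rewrite lerDl mulr_ge0 ?lam_theta_ge0 ?wsum_sqr_ge0.
Qed.

Lemma u_bounded : exists D, forall i n, nrm (u i n.+1) <= D i.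
Proof.
exists (fun i => nrm (u0 i) + (1 + lyapunov x0 u0 0 / ((lam - theta) * w i))) => i n.
apply: ipnorm_le_sqr; first by rewrite mulr_gt0 ?subr_gt0.
apply: le_trans (lyapunov_le n); apply: le_trans (lyapunov_ge x0 u0 n).
apply: le_trans (summand_le (fun i => u i n.+1 - u0 i) i lam_theta_ge0) _.
by rewrite lerDr mulr_ge0 ?ip_ge0 // ltW.
Qed.

Lemma B_diff_cvg0 : nrm (B (x n.+1) - B (x n)) @[n --> \oo] --> (0 : R).
Proof.
apply: (@squeeze_cvgr _ _ _ _ (cst 0) (fun n => L * nrm (x n.+1 - x n))).
- by apply: filterE => n /=; rewrite ipnorm_ge0 Blip.
- exact: cvg_cst.
- by rewrite -[X in _ --> X](mulr0 L); apply: cvgMl_tmp; exact: x_diff_cvg0.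
Qed.

(** The correction terms of [lyapunov] tend to 0, so the energy alone converges, as Opial's argument
    requires. *)
Lemma energy_cvg (xs : H) (us : 'I_m -> H) : primal_dual_solution xs us ->
  cvgn (fun n => energy (x n.+1 - xs) (fun i => u i n.+1 - us i)).
Proof.
move=> sol; have [D xD] := x_bounded.
have bX : ip (B (x n.+1) - B (x n)) (x n.+1 - xs) @[n --> \oo] --> (0 : R).
  apply: (ip_cvg0 ipP (K := D + nrm xs) _ B_diff_cvg0) => n.
  by apply: le_trans (ipnormD ipP _ _) _; rewrite (ipnormN ipP) lerD2r.
have pp : ip (x n.+1 - x n) (x n.+1 - x n) @[n --> \oo] --> (0 : R) * 0.
  under eq_fun do rewrite -(sqr_ipnorm ipP) expr2.
  by apply: cvgM; exact: x_diff_cvg0.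
apply/cvg_ex; exists (limn (lyapunov xs us) + 2 * 0 - L * (0 * 0)).
rewrite (_ : (fun n => energy _ _) = fun n => lyapunov xs us n
  + 2 * ip (B (x n.+1) - B (x n)) (x n.+1 - xs)
  - L * ip (x n.+1 - x n) (x n.+1 - x n)); last first.
  by apply/funext => n; rewrite /lyapunov (ipC ipP (B _ - _)); ring.
apply: cvgB; last exact: cvgMl_tmp.
apply: cvgD; last exact: cvgMl_tmp.
exact: lyapunov_cvg.
Qed.

(** The terms quadratic in the iterate cancel between the two energies; weak convergence suffices
    for the rest. *)
Lemma energy_diff_cvg (F : set_system nat) (p x1 x2 : H) (q u1 u2 : 'I_m -> H) :
  Filter F -> weak_cvg_along ip F (fun n => x n.+1) p ->
  (forall i, weak_cvg_along ip F (fun n => u i n.+1) (q i)) ->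
  energy (x n.+1 - x1) (fun i => u i n.+1 - u1 i)
    - energy (x n.+1 - x2) (fun i => u i n.+1 - u2 i) @[n --> F]
  --> energy (p - x1) (fun i => q i - u1 i) - energy (p - x2) (fun i => q i - u2 i).
Proof.
move=> FF xp uq.
pose g i z v : R := gam^-1 * (2 * ip z (x2 - x1)) + lam * (2 * ip v (u2 i - u1 i))
   - 2 * (ip z (u2 i - u1 i) + ip v (x2 - x1))
   + (gam^-1 * (ip x1 x1 - ip x2 x2) + lam * (ip (u1 i) (u1 i) - ip (u2 i) (u2 i))
      - 2 * (ip x1 (u1 i) - ip x2 (u2 i))).
have energyB z v : energy (z - x1) (fun i => v i - u1 i)
    - energy (z - x2) (fun i => v i - u2 i) = \sum_(i < m) w i * g i z (v i).
  rewrite -sumrB; apply: eq_bigr => i _; rewrite /g !(ipE ipP).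
  rewrite (ipC ipP x1 z) (ipC ipP x2 z) (ipC ipP (u1 i) (v i)) (ipC ipP (u2 i) (v i)).
  rewrite ?(ipC ipP (v i)); ring.
rewrite energyB; under eq_fun do rewrite energyB.
apply: cvg_big => [|i _]; first exact: add_continuous.
apply: cvgMl_tmp; apply: cvgD; last exact: cvg_cst.
apply: cvgB.
  by apply: cvgD; do 2!apply: cvgMl_tmp; [exact: xp|exact: uq].
by apply: cvgMl_tmp; apply: cvgD; [exact: xp|exact: uq].
Qed.

(* Opial's argument: the difference of two energies is affine in the iterate, so
   its limit can be computed from either weak limit. *)
Lemma weak_limits_agree (F G : set_system nat) (x1 x2 : H) (u1 u2 : 'I_m -> H) :
  ProperFilter F -> ProperFilter G -> \oo `<=` F -> \oo `<=` G ->
  primal_dual_solution x1 u1 -> primal_dual_solution x2 u2 ->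
  weak_cvg_along ip F (fun n => x n.+1) x1 ->
  (forall i, weak_cvg_along ip F (fun n => u i n.+1) (u1 i)) ->
  weak_cvg_along ip G (fun n => x n.+1) x2 ->
  (forall i, weak_cvg_along ip G (fun n => u i n.+1) (u2 i)) ->
  x1 = x2.
Proof.
move=> FF GF ooF ooG s1 s2 xF uF xG uG.
pose d n := energy (x n.+1 - x1) (fun i => u i n.+1 - u1 i)
  - energy (x n.+1 - x2) (fun i => u i n.+1 - u2 i).
have [l dl] : exists l : R, d n @[n --> \oo] --> l.
  by exists (limn (fun n => energy (x n.+1 - x1) (fun i => u i n.+1 - u1 i))
    - limn (fun n => energy (x n.+1 - x2) (fun i => u i n.+1 - u2 i)));
    apply: cvgB; exact: energy_cvg.
(* Convergence along [\oo] passes to finer filters, so each weak limit yields the same [l]. *)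
have lE (F' : set_system nat) p q : ProperFilter F' -> \oo `<=` F' ->
    weak_cvg_along ip F' (fun n => x n.+1) p ->
    (forall i, weak_cvg_along ip F' (fun n => u i n.+1) (q i)) ->
    energy (p - x1) (fun i => q i - u1 i) - energy (p - x2) (fun i => q i - u2 i) = l.
  move=> PF' ooF' xp uq.
  have dp := energy_diff_cvg (x1 := x1) (x2 := x2) (u1 := u1) (u2 := u2) _ xp uq.
  exact: (@cvg_unique _ (@Rhausdorff R) (d @ F') _ _ _ (dp _)
    (cvg_trans (cvg_app d ooF') dl)).
have lF := lE _ _ _ FF ooF xF uF; have lG := lE _ _ _ GF ooG xG uG.
have energy0 z v : energy (z - z) (fun i => v i - v i) = 0.
  by apply: big1 => i _; rewrite !subrr !(ipE ipP); ring.
have energyN : energy (x2 - x1) (fun i => u2 i - u1 i) = energy (x1 - x2) (fun i => u1 i - u2 i).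
  by apply: eq_bigr => i _; rewrite -(opprB x1) -(opprB (u1 i)) !(ipNl ipP) !(ipNr ipP) !opprK.
have := energy_ge (x1 - x2) (fun i => u1 i - u2 i).
have := wsum_sqr_ge0 (fun i => u1 i - u2 i).
(* The first limit gives minus the energy between the two solutions, the second gives plus; both
   equal [l], so this energy is 0. *)
move: lF lG; rewrite !energy0 energyN.
set E := energy _ _; set S := \sum_(_ < _) _ => lF lG S0 Ege.
have {}Ege : (gam^-1 - theta^-1) * ip (x1 - x2) (x1 - x2) <= 0.
  by have := mulr_ge0 lam_theta_ge0 S0; lra.
apply/eqP; rewrite -subr_eq0; apply/eqP/(ip_eq0 ipP)/le_anti.
rewrite (ip_ge0 ipP) andbT -(pmulr_rle0 _ (_ : 0 < gam^-1 - theta^-1)) //.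
have : 0 < beta^-1 by rewrite invr_gt0.
by move: gap L0; lra.
Qed.

Lemma ultrafilter_limit_solution (F : set_system nat) :
  UltraFilter F -> \oo `<=` F ->
  exists xs us, [/\ primal_dual_solution xs us,
    weak_cvg_along ip F (fun n => x n.+1) xs &
    forall i, weak_cvg_along ip F (fun n => u i n.+1) (us i)].
Proof.
move=> FU ooF; have [D xD] := x_bounded; have [D' uD'] := u_bounded.
have [xs xw] := bounded_weak_limit ipP cplt FU xD.
have /choice[us uw] := fun i => bounded_weak_limit ipP cplt FU (uD' i).
exists xs, us; split=> //.
have K0 : 0 < L + beta^-1 by rewrite addr_gt0 ?invr_gt0.
apply: (weak_limit_is_zero ipP _ hA K0 forward_monotone forward_lipschitz xD
  (D' := D') (a := fun i n => w i *: u i n.+1) (y := fun i n => y i n.+1) _ _ _ _ xw).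
- move=> i n; rewrite (ipnormZ ipP) gtr0_norm //.
  by apply: le_trans (uD' i n); rewrite ler_piMl ?ipnorm_ge0.
- by move=> i n; exact: A_yu.
(* The gap between [y i] and [x] is a combination of increments of [x] and [u i]. *)
- move=> i; apply: cvg_trans (cvg_app _ ooF) _.
  apply: (@squeeze_cvgr _ _ _ _ (cst 0)
    (fun n => nrm (x n.+1 - x n) + lam * nrm (u i n.+1 - u i n))).
  + apply: filterE => n /=; rewrite ipnorm_ge0 /=.
    have -> : y i n.+1 - x n.+1 = (x n.+1 - x n) + - (lam *: (u i n.+1 - u i n)).
      by rewrite y_eq scaler_nat mulr2n addrAC; congr (_ - _); rewrite addrAC addrK.
    apply: le_trans (ipnormD ipP _ _) _.
    by rewrite (ipnormN ipP) (ipnormZ ipP) gtr0_norm.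
  + exact: cvg_cst.
  + rewrite -[X in _ --> X](addr0 0) -{2}(mulr0 lam); apply: cvgD; first exact: x_diff_cvg0.
    by apply: cvgMl_tmp; exact: u_diff_cvg0.
(* By the recursion, the residual consists of an increment of [x] divided by [gam] and an increment
   of [B]. *)
- apply: cvg_trans (cvg_app _ ooF) _.
  apply: (@squeeze_cvgr _ _ _ _ (cst 0)
    (fun n => gam^-1 * nrm (x n.+2 - x n.+1) + nrm (B (x n.+1) - B (x n)))).
  + apply: filterE => n /=; rewrite ipnorm_ge0 /=.
    have -> : \sum_(i < m) w i *: u i n.+1 + (B (x n.+1) + C (x n.+1))
        = - (gam^-1 *: (x n.+2 - x n.+1)) - (B (x n.+1) - B (x n)).
      rewrite x_step [_ - _ - x n.+1]addrC addKr scalerN opprK scalerA mulVf ?gt_eqF //.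
      rewrite scale1r scaler_nat mulr2n opprB [RHS]addrAC -[X in _ = X + _]addrA.
      by rewrite [X in _ = _ + X + _]addrA subrK addrK addrA.
    apply: le_trans (ipnormD ipP _ _) _.
    by rewrite !(ipnormN ipP) (ipnormZ ipP) gtr0_norm ?invr_gt0.
  + exact: cvg_cst.
  + rewrite -[X in _ --> X](addr0 0) -{1}(mulr0 gam^-1); apply: cvgD; last exact: B_diff_cvg0.
    apply: cvgMl_tmp; rewrite (cvg_shiftS (fun n => nrm (x n.+1 - x n))).
    exact: x_diff_cvg0.
- move=> i z; rewrite (ipZl ipP); under eq_fun do rewrite (ipZl ipP).
  by apply: cvgMl_tmp; exact: uw.
Qed.

(** If the limit along one ultrafilter were not that of the sequence, an ultrafilter on the
    exceptional indices would have a limit different from it, against uniqueness. *)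
Lemma iteration_weak_cvg :
  exists xs us, primal_dual_solution xs us /\ weakly_converges ip x xs.
Proof.
have [F [FU ooF]] := @ultraFilterLemma _ (nbhs \oo) _.
have [xs [us [sol xF uF]]] := ultrafilter_limit_solution FU ooF.
exists xs, us; split => // z.
rewrite -(cvg_shiftS (fun n => ip (x n) z)) => U Uz /=.
set f := fun n => ip (x n.+1) z; apply: contrapT => nU.
pose V : set nat := ~` (f @^-1` U).
(* Since [f] is not eventually in [U], the set [V] meets every tail. *)
have VP : ProperFilter (within V \oo).
  apply: Build_ProperFilter => V0; apply: nU; move: V0; apply: (@filterS _ \oo) => n /= nV.
  by apply: contrapT.
have [G [GU VG]] := ultraFilterLemma VP.
have ooG : \oo `<=` G by move=> S S_oo; apply: VG; apply: filterS S_oo.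
have [xs' [us' [sol' xG uG]]] := ultrafilter_limit_solution GU ooG.
have xsE := weak_limits_agree _ _ ooF ooG sol sol' xF uF xG uG.
have GV : G V by apply: VG; apply: (@filterE _ \oo).
have GfU : G (f @^-1` U) by apply: (xG z); rewrite -xsE.
by have [n []] := filter_ex (filterI GV GfU).
Qed.

End Trajectory.
End Iteration.

(** The upper bound on [gam] is the reciprocal of [lam^-1 + 2 * L + beta^-1]; strictness leaves room
    to replace [lam] by a smaller [theta]. *)
Lemma step_size_split (R : realType) (lam gam beta L : R) :
  0 < lam -> 0 < beta -> 0 < L ->
  0 < gam < lam * beta / (beta + lam * (2 * beta * L + 1)) ->
  exists theta, [/\ 0 < theta, theta < lam & theta^-1 + 2 * L + beta^-1 < gam^-1].
Proof.
move=> lam0 beta0 L0 /andP[gam0 gam_lt].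
have bL0 : 0 < 2 * beta * L by rewrite !mulr_gt0.
have den0 : 0 < beta + lam * (2 * beta * L + 1) by rewrite addr_gt0 ?mulr_gt0 ?addr_gt0.
have gap : lam^-1 + 2 * L + beta^-1 < gam^-1.
  have -> : lam^-1 + 2 * L + beta^-1 =
      (lam * beta / (beta + lam * (2 * beta * L + 1)))^-1.
    by field; rewrite !gt_eqF.
  by rewrite ltf_pV2 ?posrE // divr_gt0 ?mulr_gt0.
have lamV0 : 0 < lam^-1 by rewrite invr_gt0.
(* Half of the slack goes into [t]; the other half keeps the last inequality strict. *)
pose t := lam^-1 + (gam^-1 - (lam^-1 + 2 * L + beta^-1)) / 2.
have t_gt : lam^-1 < t by rewrite /t; lra.
have t0 : 0 < t by apply: lt_trans t_gt.
exists t^-1; split; first by rewrite invr_gt0.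
  by rewrite -[ltRHS]invrK ltf_pV2 ?posrE.
by rewrite invrK /t; lra.
Qed.

(** * Reduction of the algorithm to the abstract iteration *)

Theorem theorem4p3 (R : realType) (H : lmodType R) (ip : H -> H -> R)
  (hH : is_hilbert ip)
  (m : nat) (hm : (1 <= m)%N)
  (A : 'I_m -> H -> set H) (hA : forall i, maximally_monotone ip (A i))
  (B : H -> H) (L : R) (hL : 0 < L) (hBm : monotone_fun ip B)
  (hBL : lipschitz_fun ip L B)
  (C : H -> H) (beta : R) (hbeta : 0 < beta) (hC : cocoercive ip beta C)
  (hzer : exists x, is_zero_of_sum A B C x)
  (w : 'I_m -> R) (hw : forall i, 0 < w i <= 1) (hwsum : \sum_(i < m) w i = 1)
  (lam gam : R) (hlam : 0 < lam)
  (hgam : 0 < gam < lam * beta / (beta + lam * (2 * beta * L + 1)))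
  (x : nat -> H) (xm1 : H) (u y : 'I_m -> nat -> H)
  (hx : forall n, x n.+1 =
     \sum_(j < m) w j *: (x n - gam *: u j n
         - gam *: (2 *: B (x n) - B (if n is k.+1 then x k else xm1))
         - gam *: C (x n)))
  (hy : forall i n,
     resolvent_eq (scale_op (lam / w i) (A i)) (2 *: x n.+1 - x n + lam *: u i n)
       (y i n.+1))
  (hu : forall i n,
     u i n.+1 = u i n + lam^-1 *: (2 *: x n.+1 - x n - y i n.+1)) :
  exists xs : H, is_zero_of_sum A B C xs /\ weakly_converges ip x xs.
Proof.
have [ipP cplt] := hH.
have [theta [theta0 theta_lt gap]] := step_size_split hlam hbeta hL hgam.
have gam0 : 0 < gam by case/andP: hgam.
have w0 i : 0 < w i by case/andP: (hw i).
have w1 i : w i <= 1 by case/andP: (hw i).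
have lam_neq0 : lam != 0 by rewrite gt_eqF.
have luE i n : lam *: u i n.+1 = 2 *: x n.+1 - x n + lam *: u i n - y i n.+1.
  by rewrite hu scalerDr scalerA mulfV // scale1r addrC addrAC.
(* The resolvent residual is [lam *: u i n.+1]; scaling it by [w i / lam] undoes the factor
   [lam / w i]. *)
have A_yu i n : A i (y i n.+1) (w i *: u i n.+1).
  have [v Av] := hy i n; rewrite -luE => /(congr1 ( *:%R (w i / lam))).
  have wn0 : w i != 0 by rewrite gt_eqF.
  rewrite !scalerA (_ : w i / lam * (lam / w i) = 1); last by field; rewrite wn0.
  by rewrite (_ : w i / lam * lam = w i) ?scale1r => [<-|]; last by field.
have y_eq i n : y i n.+1 = 2 *: x n.+1 - x n - lam *: (u i n.+1 - u i n).
  rewrite scalerBr luE; set z := 2 *: _ - _.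
  by rewrite [z + _ - _ - _]addrAC addrK opprB addrC subrK.
(* From [x n.+2] on, the reflection uses only genuine iterates and [xm1] disappears; weights of sum
   1 collapse the average. *)
have x_step n : x n.+2 = x n.+1 - gam *:
    (\sum_(j < m) w j *: u j n.+1 + (2 *: B (x n.+1) - B (x n)) + C (x n.+1)).
  rewrite hx /= ; set b := 2 *: _ - _; set c := C _.
  under eq_bigr => j _ do rewrite -!addrA -!opprD -!scalerDr scalerBr.
  rewrite sumrB -scaler_suml hwsum scale1r; congr (_ - _).
  under [LHS]eq_bigr => j _ do rewrite scalerA mulrC -scalerA scalerDr.
  rewrite -scaler_sumr big_split /= -scaler_suml hwsum scale1r.
  by rewrite addrA.
have [x0 [a [Aa a0]]] := hzer.
have sol0 : primal_dual_solution A B C w x0 (fun i => (w i)^-1 *: a i).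
  have wK i : w i *: ((w i)^-1 *: a i) = a i.
    by rewrite scalerA mulfV ?scale1r ?gt_eqF.
  split=> [i|]; first by rewrite wK.
  by under eq_bigr do rewrite wK; rewrite addrA.
have [xs [us [[Axs sum0] xw]]] :=
  iteration_weak_cvg ipP cplt hA hL hBm hBL hbeta hC w0 w1 hwsum hlam gam0 theta0
    theta_lt gap x_step A_yu y_eq sol0.
exists xs; split=> //; exists (fun i => w i *: us i); split=> //.
by rewrite -addrA.
Qed.
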